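(* Let $n\ge 1$ and $0\le m\le t_2(n)$ be integers. Then $$f(n,m)=\min\{r\ge 1 : t_2(r)\ge m\}-1,$$ where the minimum is over integers $r \geq 1$.
   Context: All graphs are finite and simple. A graph is chordal if it contains no induced cycle of length at least $4$. Subgraphs are not required to be induced. For integers $n\ge 1$ and $0\le m\le \binom n2$, $f(n,m)$ denotes the maximum integer such that every graph with $n$ vertices and $m$ edges contains a chordal subgraph with at least $f(n,m)$ edges. $t_2(r)=\lfloor r^2/4\rfloor$ is the number of edges of the Turán graph $T_2(r)$, the balanced complete bipartite graph on $r$ vertices. *)

(* Defs.v *)
From mathcomp Require Import all_boot boolp.

Set Implicit Arguments.
Unset Strict Implicit.
Unset Printing Implicit Defensive.

(* Finite simple graphs whose vertices form a subset of a finite type, so that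
   a subgraph may have fewer vertices as well as fewer edges. *)
Record graph (T : finType) := Graph {
  vertices : {set T};
  edges : {set {set T}};
  edgesP : forall e, e \in edges -> (e \subset vertices) && (#|e| == 2)
}.

Definition adj (T : finType) (G : graph T) (x y : T) : bool :=
  [set x; y] \in edges G.

Definition subgraph (T : finType) (H G : graph T) : Prop :=
  vertices H \subset vertices G /\ edges H \subset edges G.

(* ordS is the cyclic successor on 'I_k. *)
Definition induced_cycle (T : finType) (G : graph T) (k : nat)
    (c : 'I_k -> T) : Prop :=
  [/\ injective c,
      forall i, c i \in vertices G
    & forall i j, adj G (c i) (c j) = (j == ordS i) || (i == ordS j)].

Definition chordal (T : finType) (G : graph T) : Prop :=
  forall (k : nat) (c : 'I_k -> T), 4 <= k -> ~ induced_cycle G c.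

Definition forces_chordal (n m k : nat) : Prop :=
  forall (T : finType) (G : graph T), #|vertices G| = n -> #|edges G| = m ->
  exists H : graph T, [/\ subgraph H G, chordal H & k <= #|edges H|].

(* The bound 'C(n, 2) only makes the maximum finite: by chordal_fP, for
   m <= 'C(n, 2) this is the maximum over all natural numbers. *)
Definition chordal_f (n m : nat) : nat :=
  \max_(k < 'C(n, 2).+1 | `[< forces_chordal n m k >]) k.

Definition t2 (r : nat) : nat := r ^ 2 %/ 4.

Lemma t2_unbounded (m : nat) : exists r, (1 <= r) && (m <= t2 r).
Proof.
exists (m.+1 * 2); rewrite muln_gt0 /=.
by rewrite /t2 expnMn mulnK // (leq_trans (leqnSn m)) // leq_pmulr.
Qed.

Definition min_t2 (m : nat) : nat := ex_minn (t2_unbounded m).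

Lemma graph_exists (n m : nat) : m <= 'C(n, 2) ->
  exists G : graph 'I_n, #|vertices G| = n /\ #|edges G| = m.
Proof.
move=> le_m; pose D := [set A : {set 'I_n} | #|A| == 2].
have cD : #|D| = 'C(n, 2) by rewrite card_draws card_ord.
pose s := take m (enum D).
have sP e : e \in [set:: s] -> (e \subset [set: 'I_n]) && (#|e| == 2).
  by rewrite inE => /mem_take; rewrite mem_enum inE subsetT.
exists (Graph sP); split; first by rewrite cardsT card_ord.
rewrite /= cardsE (card_uniqP _) ?take_uniq ?enum_uniq //.
by rewrite size_takel // -cardE cD.
Qed.

Lemma forces_chordal0 (n m : nat) : forces_chordal n m 0.
Proof.
move=> T G _ _.
have P e : e \in (set0 : {set {set T}}) ->
  (e \subset vertices G) && (#|e| == 2) by rewrite inE.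
exists (Graph P); split=> //; first by split=> //=; apply: sub0set.
move=> [//|k] c k4 [_ _ /(_ ord0 (ordS ord0))].
by rewrite /adj inE eqxx.
Qed.

Lemma chordal_fP (n m : nat) : m <= 'C(n, 2) ->
  forces_chordal n m (chordal_f n m) /\
  (forall k, forces_chordal n m k -> k <= chordal_f n m).
Proof.
move=> le_m; split.
  rewrite /chordal_f; elim/big_ind: _ => [|x y fx fy|i /asboolP //].
    exact: forces_chordal0.
  by rewrite /maxn; case: ifP.
move=> k fk; have [G [vG eG]] := graph_exists le_m.
have [H [[_ sHG] _ kH]] := fk _ G vG eG.
have le_k : k < 'C(n, 2).+1.
  by rewrite ltnS (leq_trans kH) // (leq_trans (subset_leq_card sHG)) // eG.
rewrite /chordal_f (bigD1 (Ordinal le_k)) /=; last exact/asboolP.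
exact: leq_maxl.
Qed.

(* Main.v *)
(* Upper bound: take [m] edges of the Turan graph on [r] vertices, all other
   vertices being isolated. A chordal subgraph of a bipartite graph is a forest,
   since a longest induced path in a triangle-free graph of minimum degree 2
   closes up to an induced cycle of length at least 4.

   Lower bound: a graph with [m] edges has a chordal subgraph with [k] edges
   such that [m <= t2 (k + 1)]. Since [t2 (a+1) + t2 (b+1) <= t2 (a+b+1)], it is
   enough to treat a connected graph, on [w] vertices say. A spanning tree has
   [w - 1] edges. For an edge [xy], the edges meeting [{x, y}] form a chordal
   graph, a book with pendant edges, with [d x + d y - 1] edges. With [K] the
   maximum of [d x + d y] over the edges, double counting gives
   [4 m <= K w <= (max K w) ^ 2]. *)
Require Import Defs.
From mathcomp Require Import all_boot boolp zify.

Set Implicit Arguments.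
Unset Strict Implicit.
Unset Printing Implicit Defensive.

(** * Arithmetic of [t2] *)

(** Without the floors this amounts to [1 <= 2 * a * b], hence the separate cases [a = 0] and
    [b = 0], where [t2 1 = 0]. *)
Lemma t2_superadd (a b : nat) : t2 a.+1 + t2 b.+1 <= t2 (a + b).+1.
Proof.
rewrite /t2; case: a => [|a]; first by [].
case: b => [|b]; first by rewrite !addn0.
rewrite leq_divRL // mulnDl.
apply: leq_trans (_ : a.+2 ^ 2 + b.+2 ^ 2 <= _).
  by apply: leq_add; exact: leq_divM.
nia.
Qed.

Lemma t2_half (r : nat) : t2 r = r./2 * (r - r./2).
Proof.
rewrite /t2; set h := r./2.
have: r = odd r + h.*2 by rewrite odd_double_half.
case: (odd r) => -> /=; last first.
  rewrite add0n -addnn addnK.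
  by rewrite (_ : (h + h) ^ 2 = h * h * 4) ?mulnK //; nia.
rewrite (_ : (1 + h.*2) ^ 2 = h * h.+1 * 4 + 1); last by nia.
by rewrite divnMDl // addn0; congr (_ * _); lia.
Qed.

(** * Chordality of edge sets *)

Section Chordal.

Variable T : finType.
Implicit Types (E F : {set {set T}}) (W S : {set T}) (x y z : T) (e : {set T}).

Definition loopless E := forall e, e \in E -> #|e| = 2.

(** Membership of the vertices is dropped from [induced_cycle], since every vertex of a cycle lies
    on an edge. *)
Definition chordal_edges E := forall (k : nat) (c : 'I_k -> T),
  4 <= k -> injective c ->
  ~ forall i j, ([set c i; c j] \in E) = (j == ordS i) || (i == ordS j).

Lemma chordal_edgesP (G : graph T) : chordal_edges (edges G) <-> chordal G.
Proof.
split=> [chG k c k4 [] | chG k c k4 c_inj cE]; first by move=> ? _; exact: chG.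
apply: (chG k c k4); split=> // i.
have: [set c i; c (ordS i)] \in edges G by rewrite cE eqxx.
by case/edgesP/andP => /subsetP/(_ (c i)); rewrite !inE eqxx => ->.
Qed.

Definition simplicial E x := forall y z, y != z ->
  [set x; y] \in E -> [set x; z] \in E -> [set y; z] \in E.

(** The two neighbours of [c i] along the cycle are distinct and, since [4 <= k], not adjacent. *)
Lemma induced_cycle_not_simplicial E (k : nat) (c : 'I_k -> T) (i : 'I_k) :
    4 <= k -> injective c ->
    (forall i j, ([set c i; c j] \in E) = (j == ordS i) || (i == ordS j)) ->
  ~ simplicial E (c i).
Proof.
move=> k4 c_inj cE /(_ (c (ordS i)) (c (ord_pred i))).
rewrite (inj_eq c_inj) !cE !eqxx ord_predK eqxx orbT.
have ik := ltn_ord i.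
(* The cyclic neighbours are computed without [%%], for [lia] to compare. *)
have m1 : ordS i = (if i.+1 == k then 0 else i.+1) :> nat.
  by rewrite /=; case: eqP => [->|?]; [rewrite modnn | rewrite modn_small //; lia].
have m2 : ord_pred i = (if i == 0 :> nat then k.-1 else i.-1) :> nat.
  rewrite /=; case: eqP => [->|?]; first by rewrite add0n modn_small //; lia.
  by rewrite (_ : (i + k).-1 = i.-1 + k) ?modnDr ?modn_small //; lia.
have m3 : ordS (ordS i) = (if i.+2 < k then i.+2 else i.+2 - k) :> nat.
  rewrite /= -[(_ %% k).+1]addn1 modnDml addn1.
  case: ifP => ?; first by rewrite modn_small.
  by rewrite -{1}[i.+2](@subnK k) ?modnDr ?modn_small //; lia.
have ne1 : ordS i != i.
  by apply/eqP => /(congr1 (@nat_of_ord k)); rewrite m1; case: eqP; lia.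
have ne2 : ordS i != ord_pred i.
  apply/eqP => /(congr1 (@nat_of_ord k)); rewrite m1 m2.
  by case: eqP; case: eqP; lia.
have ne3 : ord_pred i != ordS (ordS i).
  apply/eqP => /(congr1 (@nat_of_ord k)); rewrite m2 m3.
  by case: eqP; case: ifP; lia.
by move=> /(_ ne2 isT isT); rewrite (negPf ne1) (negPf ne3).
Qed.

Lemma set2_pair x y a b : [set x; y] = [set a; b] ->
  (x = a /\ y = b) \/ (x = b /\ y = a).
Proof.
move=> eq_xy.
have: x \in [set a; b] by rewrite -eq_xy set21.
have: y \in [set a; b] by rewrite -eq_xy set22.
have: a \in [set x; y] by rewrite eq_xy set21.
have: b \in [set x; y] by rewrite eq_xy set22.
rewrite !inE => /orP[]/eqP ? /orP[]/eqP ? /orP[]/eqP ? /orP[]/eqP ?;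
  by [left; split; congruence | right; split; congruence].
Qed.

Lemma loopless_neq E x y : loopless E -> [set x; y] \in E -> x != y.
Proof. by move=> lE /lE; rewrite cards2; case: eqP. Qed.

Lemma loopless_edge E e x : loopless E -> e \in E -> x \in e ->
  exists2 y, x != y & e = [set x; y].
Proof.
move=> lE /lE /eqP/cards2P[a [b [ab ->]]]; rewrite !inE => /orP[]/eqP->.
  by exists b.
by exists a; [rewrite eq_sym | rewrite setUC].
Qed.

Lemma chordal_edges0 : chordal_edges set0.
Proof.
move=> [//|k] c k4 c_inj /(_ ord0 (ordS ord0)).
by rewrite inE eqxx.
Qed.

(** The new vertex [y] has [x] as its only neighbour, so it is simplicial and no induced cycle
    passes through it. *)
Lemma chordal_pendant E x y : loopless E -> chordal_edges E ->
  (forall e, e \in E -> y \notin e) -> x != y ->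
  chordal_edges ([set x; y] |: E).
Proof.
move=> lE chE yE xy k c k4 c_inj cE.
have yc i : c i != y.
  apply/eqP => ciy; apply: (induced_cycle_not_simplicial (i := i) k4 c_inj cE).
  have nbr a : [set y; a] \in [set x; y] |: E -> a = x.
    case/setU1P => [/set2_pair[[]|[]] // -> //|/yE].
    by rewrite set21.
  rewrite ciy => a b ab /nbr ea /nbr eb.
  by rewrite ea eb eqxx in ab.
apply: (chE k c k4 c_inj) => i j; rewrite -cE in_setU1.
case: eqP => // /set2_pair[[_ /eqP]|[/eqP]]; first by rewrite (negPf (yc j)).
by rewrite (negPf (yc i)).
Qed.

(** Consecutive vertices of a cycle lie on the same side of [S], so the whole cycle does and uses
    the edges of one set only. *)
Lemma chordal_union E F S : chordal_edges E -> chordal_edges F ->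
  (forall e, e \in E -> e \subset S) -> (forall e, e \in F -> e \subset ~: S) ->
  chordal_edges (E :|: F).
Proof.
move=> chE chF sE sF [//|k] c k4 c_inj cE.
have step i : (c (ordS i) \in S) = (c i \in S).
  have: [set c i; c (ordS i)] \in E :|: F by rewrite cE eqxx.
  case/setUP => [/sE|/sF]; rewrite subUset !sub1set ?inE => /andP[].
    by move=> -> ->.
  by move=> /negPf-> /negPf->.
have const i : (c i \in S) = (c ord0 \in S).
  case: i => i ik; elim: i ik => [|i IH] ik.
    by congr (c _ \in S); apply: val_inj.
  have ik' : i < k.+1 by exact: ltnW.
  rewrite -(IH ik') -[RHS]step; congr (c _ \in S); apply: val_inj => /=.
  by rewrite modn_small.
case: (boolP (c ord0 \in S)) => c0S.
  apply: (chE _ c k4 c_inj) => i j; rewrite -cE inE orbC.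
  case: (boolP (_ \in F)) => // /sF.
  by rewrite subUset sub1set inE const c0S.
apply: (chF _ c k4 c_inj) => i j; rewrite -cE inE.
case: (boolP (_ \in E)) => // /sE.
by rewrite subUset sub1set const (negPf c0S).
Qed.

(** A vertex outside [[set x; y]] has no neighbours but [x] and [y], which are adjacent. Being
    simplicial it lies on no induced cycle, and two vertices are too few for one. *)
Lemma chordal_double_star E x y : loopless E -> [set x; y] \in E ->
  chordal_edges [set e in E | (x \in e) || (y \in e)].
Proof.
move=> lE xyE k c k4 c_inj cE.
have xy i : c i \in [set x; y].
  apply: contra_notT (induced_cycle_not_simplicial (i := i) k4 c_inj cE) => ci.
  have nbr a : [set c i; a] \in [set e in E | (x \in e) || (y \in e)] ->
      a = x \/ a = y.
    move: ci; rewrite !inE !negb_or => /andP[cx cy] /andP[_].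
    rewrite ![_ == c i]eq_sym (negPf cx) (negPf cy) /= => /orP[]/eqP; auto.
  move=> a b ab /nbr[] ea /nbr[] eb; rewrite ea eb ?eqxx // in ab *.
    by rewrite inE xyE set21.
  by rewrite setUC inE xyE set21.
have: #|[set c i | i in 'I_k]| <= #|[set x; y]|.
  by apply/subset_leq_card/subsetP => _ /imsetP[i _ ->].
rewrite card_imset // cardT size_enum_ord cards2; lia.
Qed.

(** * Degrees and double counting *)

Definition degree E x := #|[set e in E | x \in e]|.

Lemma card_double_star E x y : loopless E -> [set x; y] \in E ->
  #|[set e in E | (x \in e) || (y \in e)]|.+1 = degree E x + degree E y.
Proof.
move=> lE xyE; rewrite /degree -cardsUI addnC.
have -> : [set e in E | x \in e] :&: [set e in E | y \in e] = [set [set x; y]].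
  apply/setP=> e; rewrite !inE; apply/andP/eqP => [[]/andP[eE xe] /andP[_]|->].
    have [z _ ->] := loopless_edge lE eE xe; have := loopless_neq lE xyE.
    by rewrite !inE eq_sym => /negPf-> /= /eqP->.
  by rewrite xyE !inE !eqxx orbT.
rewrite cards1 add1n; congr (#|pred_of_set _|.+1).
by apply/setP=> e; rewrite !inE andb_orr.
Qed.

(** Swapping the sums counts incidences. The weight [1] gives twice the number of edges, the weight
    [degree E] the sum of squared degrees. *)
Lemma sum_edges_degree E W (w : T -> nat) : loopless E ->
    (forall e, e \in E -> e \subset W) ->
  \sum_(x in W) degree E x * w x = \sum_(e in E) \sum_(x in e) w x.
Proof.
move=> lE sE.
under eq_bigr => x _ do rewrite /degree -sum1dep_card big_distrl /= big_mkcondr.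
rewrite exchange_big /=; apply: eq_bigr => e eE.
rewrite -big_mkcondr; apply: eq_big => [x|x _]; last by rewrite mul1n.
by rewrite andbC; case: (boolP (x \in e)) => // /(subsetP (sE e eE)).
Qed.

(* Summing [4 K d <= (2 d) ^ 2 + K ^ 2] over the vertices replaces
   Cauchy-Schwarz, since [\sum_x d x ^ 2 = \sum_(xy in E) (d x + d y)]. *)
Lemma edges_degree_sum_bound E W (K : nat) : loopless E ->
    (forall e, e \in E -> e \subset W) ->
    (forall x y, [set x; y] \in E -> degree E x + degree E y <= K) ->
  4 * #|E| <= K * #|W|.
Proof.
move=> lE sE bE.
have s1 : \sum_(x in W) degree E x * 1 = #|E| * 2.
  rewrite (sum_edges_degree _ lE sE) -sum_nat_const.
  by apply: eq_bigr => e /lE <-; rewrite sum1_card.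
have s2 : \sum_(x in W) degree E x * degree E x <= #|E| * K.
  rewrite (sum_edges_degree _ lE sE) -sum_nat_const; apply: leq_sum => e eE.
  have [x xe] : exists x, x \in e by apply/card_gt0P; rewrite lE.
  have [y xy ee] := loopless_edge lE eE xe; rewrite ee in eE *.
  by rewrite big_setU1 ?big_set1 ?inE //=; exact: bE.
(* This settles [K = 0], where the factor [K] cannot be cancelled: [E] is then empty. *)
have s3 : \sum_(x in W) degree E x * 1 <= \sum_(x in W) degree E x * degree E x.
  by apply: leq_sum => x _; case: (degree E x) => // d; rewrite leq_mul.
have: \sum_(x in W) 4 * K * (degree E x * 1) <=
    \sum_(x in W) (4 * (degree E x * degree E x) + K * K).
  apply: leq_sum => x _; have := (nat_Cauchy (2 * degree E x) K).1.
  by rewrite -!mulnn; nia.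
rewrite big_split /= sum_nat_const -!big_distrr /= s1.
move: s2 s3; rewrite s1; set s := \sum_(x in W) _.
move: s #|E| #|W| => s m n; case: (posnP K) => [->|K0] s2 s3 s4; first lia.
by rewrite -(leq_pmul2l K0); nia.
Qed.

(** * Lower bound: large chordal subgraphs *)

(** Connectedness of [W] is expressed as the absence of such an [S], which avoids reasoning about
    paths. *)
Definition separated E W S :=
  [&& S != set0, S \proper W
    & [forall e in E, (e \subset S) || (e \subset ~: S)]].

(** A tree on [S] grows by one pendant edge at a time: as [S] does not separate [W], some edge
    leaves it. The case [j = #|W|.-1] is a spanning tree. *)
Lemma connected_forest E W (j : nat) : loopless E ->
    (forall e, e \in E -> e \subset W) -> (forall S, ~~ separated E W S) ->
    j < #|W| ->
  exists S F, [/\ S \subset W, #|S| = j.+1 &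
    [/\ F \subset E, chordal_edges F, #|F| = j
      & forall e, e \in F -> e \subset S]].
Proof.
move=> lE sE cE; elim: j => [|j IH] jW.
  have [x xW] : exists x, x \in W by exact/card_gt0P.
  exists [set x], set0; rewrite sub1set xW cards1 cards0 sub0set.
  by split=> //; split=> // [|e]; [exact: chordal_edges0 | rewrite inE].
have [S [F [SW cS [FE chF cF FS]]]] := IH (ltnW jW).
have := cE S; rewrite /separated -card_gt0 cS properEcard SW cS jW /=.
rewrite negb_forall => /existsP[e]; rewrite negb_imply negb_or.
case/and3P => eE /subsetPn[y ye yS] /subsetPn[x xe].
rewrite inE negbK => xS.
have xy : x != y by apply: contraNneq yS => <-.
have [z _ ee] := loopless_edge lE eE xe.
have ez : y = z by apply/eqP; move: ye; rewrite ee !inE eq_sym (negPf xy).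
rewrite -ez in ee.
have yF f : f \in F -> y \notin f by move/FS => /subsetP fS; apply: contra yS => /fS.
exists (y |: S), ([set x; y] |: F); split.
- by rewrite subUset SW sub1set (subsetP (sE e eE)).
- by rewrite cardsU1 yS cS.
split.
- by rewrite subUset FE sub1set -ee eE.
- apply: chordal_pendant => // f fF; exact/lE/(subsetP FE).
- rewrite cardsU1 cF; case: (boolP (_ \in F)) => // /yF.
  by rewrite set22.
- move=> f /setU1P[->|/FS fS]; last exact: subset_trans fS (subsetUr _ _).
  by rewrite subUset !sub1set !inE xS eqxx orbT.
Qed.

Lemma t2_chordal_subgraph E W : loopless E -> (forall e, e \in E -> e \subset W) ->
  exists F, [/\ F \subset E, chordal_edges F & #|E| <= t2 #|F|.+1].
Proof.
move: {2}#|W| (leqnn #|W|) => n; elim: n => [|n IH] in E W *; move=> Wn lE sE.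
  exists set0; rewrite sub0set cards0; split=> //; first exact: chordal_edges0.
  suff -> : E = set0 by rewrite cards0.
  apply/eqP/set0Pn => -[e eE]; have := subset_leq_card (sE e eE).
  by rewrite lE //; lia.
case: (pickP (separated E W)) => [S /and3P[S0 SW /forall_inP sepS]|sep0].
  pose E1 := [set e in E | e \subset S].
  pose E2 := [set e in E | e \subset ~: S].
  have E12 : E = E1 :|: E2.
    apply/setP=> e; rewrite !inE -andb_orr.
    by case: (boolP (e \in E)) => // /sepS ->.
  have [|||F1 [FE1 ch1 m1]] := IH E1 S.
  - by have := proper_card SW; lia.
  - by move=> e /setIdP[/lE].
  - by move=> e /setIdP[].
  have [|||F2 [FE2 ch2 m2]] := IH E2 (W :\: S).
  - rewrite cardsD (setIidPr (proper_sub SW)).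
    by move: S0; rewrite -card_gt0; lia.
  - by move=> e /setIdP[/lE].
  - by move=> e /setIdP[/sE eW eS]; rewrite setDE subsetI eW.
  have s1 e : e \in F1 -> e \subset S by move/(subsetP FE1)/setIdP => [].
  have s2 e : e \in F2 -> e \subset ~: S by move/(subsetP FE2)/setIdP => [].
  exists (F1 :|: F2); split.
  - by rewrite E12 setUSS.
  - exact: chordal_union s1 s2.
  have F12 : F1 :&: F2 = set0.
    apply/eqP/set0Pn => -[e /setIP[eF1 eF2]].
    have [x xe] : exists x, x \in e.
      by apply/card_gt0P; rewrite lE // E12 inE (subsetP FE1).
    by have := subsetP (s2 e eF2) x xe; rewrite inE (subsetP (s1 e eF1)).
  rewrite cardsU F12 cards0 subn0 E12.
  apply: leq_trans (leq_card_setU _ _) _.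
  by apply: leq_trans (t2_superadd _ _); exact: leq_add.
have sepN S : ~~ separated E W S by rewrite sep0.
have [->|[e0 e0E]] := set_0Vmem E.
  exists set0; rewrite sub0set cards0; split=> //; exact: chordal_edges0.
pose K := \max_(p : T * T | [set p.1; p.2] \in E) (degree E p.1 + degree E p.2).
have bK x y : [set x; y] \in E -> degree E x + degree E y <= K.
  by move=> xyE; exact: (@leq_bigmax_cond _ _ _ (x, y)).
have mK := edges_degree_sum_bound lE sE bK.
have [x0 x0e] : exists x, x \in e0 by apply/card_gt0P; rewrite lE.
(* [#|F|.+1] is [#|W|] for a spanning tree and [K] for a double star at an edge attaining [K];
   choosing the larger gives [4 * #|E| <= #|F|.+1 ^ 2]. *)
case: (leqP K #|W|) => KW.
  have W0 : 0 < #|W| by apply/card_gt0P; exists x0; exact: (subsetP (sE e0 e0E)).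
  have [|S [F [_ _ [FE chF cF _]]]] := @connected_forest E W #|W|.-1 lE sE sepN.
    by rewrite prednK.
  exists F; split=> //; rewrite cF prednK // /t2 leq_divRL // -mulnn.
  by nia.
have [y0 _ ee0] := loopless_edge lE e0E x0e; rewrite ee0 in e0E.
have [|[x y] /= xyE Ke] := @eq_bigmax_cond _ [pred p | [set p.1; p.2] \in E]
    (fun p : T * T => degree E p.1 + degree E p.2).
  by apply/card_gt0P; exists (x0, y0).
exists [set e in E | (x \in e) || (y \in e)]; split.
- by apply/subsetP => e /setIdP[].
- exact: chordal_double_star.
have {}Ke : degree E x + degree E y = K by rewrite -Ke.
rewrite (card_double_star lE xyE) Ke /t2 leq_divRL // -mulnn mulnC.
by rewrite (leq_trans mK) // leq_mul2l ltnW ?orbT.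
Qed.

(** * Triangle-free chordal graphs are forests *)

Definition triangle_free E := forall x y z,
  [set x; y] \in E -> [set y; z] \in E -> [set x; z] \notin E.

(** The default [x0] never matters in range and is quantified so that each use can choose it;
    distinctness is kept apart as [uniq]. *)
Definition induced_path E (s : seq T) := forall x0 a b, a < size s -> b < size s ->
  ([set nth x0 s a; nth x0 s b] \in E) = (a.+1 == b) || (b.+1 == a).

(** With [y] at index 0, [y :: s] is the cycle; [2 < size s] makes its length at least 4. *)
Lemma induced_cycle_cons E y (s : seq T) : loopless E -> 2 < size s ->
    uniq (y :: s) -> induced_path E s ->
    (forall a, a < size s ->
       ([set y; nth y s a] \in E) = (a == 0) || (a.+1 == size s)) ->
  ~ chordal_edges E.
Proof.
move=> lE s3 Us sE yE /(_ (size s).+1 (fun i => nth y (y :: s) i)) [] //.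
  by move=> i j /eqP; rewrite nth_uniq // => /eqP/val_inj.
have loop x : [set x; x] \in E = false.
  by apply/negP => /(loopless_neq lE); rewrite eqxx.
have m c : c <= size s ->
    c.+1 %% (size s).+1 = if c == size s then 0 else c.+1.
  by move=> ?; case: eqP => [->|?]; [rewrite modnn | rewrite modn_small //; lia].
move=> i j; rewrite -!val_eqE /=; case: i j => [[|a] ai] [[|b] bj] /=.
- by rewrite loop m //; do ?case: ifP => ?; lia.
- by rewrite yE // !m //; do ?case: ifP => ?; lia.
- by rewrite setUC yE // !m //; do ?case: ifP => ?; lia.
by rewrite sE // !m //; do ?case: ifP => ?; lia.
Qed.

(** Otherwise an induced path in [W] could be lengthened at its head forever: a further neighbour of
    the head either extends it or closes an induced cycle. *)
Lemma exists_leaf E W : loopless E -> triangle_free E -> chordal_edges E ->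
  W != set0 ->
  exists2 x, x \in W & #|[set e in E | (e \subset W) && (x \in e)]| <= 1.
Proof.
move=> lE tfE chE W0; apply: contrapT => noleaf.
have deg2 x : x \in W -> forall z, exists y, [/\ y \in W, y != z & [set x; y] \in E].
  move=> xW z; apply: contrapT => noy; apply: noleaf; exists x => //.
  rewrite -(cards1 [set x; z]); apply/subset_leq_card/subsetP => e.
  rewrite !inE => /and3P[eE eW xe].
  have [y xy ee] := loopless_edge lE eE xe; rewrite ee in eE eW *.
  apply: contra_notT noy => ne; exists y; split=> //.
    by apply: (subsetP eW); rewrite set22.
  by apply: contraNneq ne => ->.
have long n : exists s, [/\ size s = n.+1, uniq s, {subset s <= W} & induced_path E s].
  elim: n => [|n [s [sz Us sW pE]]].
    have [x xW] := set0Pn _ W0; exists [:: x]; split=> //.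
      by move=> y; rewrite inE => /eqP->.
    move=> x0 [|//] [|//] _ _ /=.
    by apply/negP => /(loopless_neq lE); rewrite eqxx.
  case: s => [//|x p] in sz Us sW pE *.
  (* The neighbour [y] of [x] must avoid the second vertex of the path; if there is none, [head]
     harmlessly defaults to [x]. *)
  have [y [yW yp xy]] := deg2 x (sW _ (mem_head _ _)) (head x p).
  have yx : y != x by rewrite eq_sym; exact: loopless_neq xy.
  (* The only path vertex adjacent to [x] is the head of [p], which [y] avoids. *)
  have Uyp : uniq [:: y, x & p].
    rewrite cons_uniq Us andbT inE (negPf yx) /=; apply/negP => ypath.
    move: yp; have /= := pE x 0 (index y p).+1 isT.
    rewrite ltnS index_mem nth_index // xy orbF eqSS => /(_ ypath)/esym/eqP i0.
    by rewrite -nth0 i0 nth_index ?eqxx.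
  pose adjy z := [set y; z] \in E.
  (* The nearest neighbour of [y] on the path closes an induced cycle. *)
  case: (boolP (has adjy p)) => [hasy|nhas].
    exfalso.
    pose j := find adjy p.
    have jp : j < size p by rewrite -has_find.
    (* For [j = 0], the vertices [x], [y] and the head of [p] would form a triangle. Hence the path
       up to the first neighbour of [y] in [p] has at least 3 vertices. *)
    have j0 : 0 < j.
      rewrite lt0n; apply/negP => /eqP j0.
      have := nth_find x hasy; rewrite -/j j0 => /(tfE _ _ _ xy)/negP[].
      by rewrite (pE x 0 1) //= ltnS -j0.
    have szt : size (take j.+2 (x :: p)) = j.+2 by rewrite size_takel.
    have nt z i : i < j.+2 -> nth z (take j.+2 (x :: p)) i = nth z (x :: p) i.
      by move=> ij; rewrite nth_take.
    apply: (@induced_cycle_cons E y (take j.+2 (x :: p))) chE => //.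
    - by rewrite szt.
    - exact: (take_uniq j.+3 Uyp).
    - by rewrite /induced_path szt => z a b aj bj; rewrite !nt ?pE ?(leq_trans aj) ?(leq_trans bj).
    - rewrite szt => -[|a] aj; rewrite nt //=; first by rewrite setUC.
      rewrite !eqSS; move: aj; rewrite !ltnS leq_eqVlt.
      case: eqP => [-> _|_ /= aj]; rewrite (set_nth_default x) ?(ltn_trans aj) //.
        exact: (nth_find x hasy).
      exact: (before_find x aj).
  exists (y :: x :: p); split=> //.
  - by rewrite /= in sz *; rewrite sz.
  - by move=> z; rewrite inE => /predU1P[->|/sW].
  have nadj a x0 : a < size p -> ([set y; nth x0 p a] \in E) = false.
    move=> ap; apply: contraNF nhas => ya; apply/hasP.
    by exists (nth x0 p a); first exact: mem_nth.
  move=> x0 [|a] [|b] /= aj bj.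
  - by apply/negP => /(loopless_neq lE); rewrite eqxx.
  - by case: b bj => [|b] bj /=; [rewrite setUC xy | rewrite nadj].
  - by rewrite setUC; case: a aj => [|a] aj /=; [rewrite setUC xy | rewrite nadj].
  by rewrite (pE x0 a b).
have [s [sz Us sW _]] := long #|W|.
have /subset_leq_card : s \subset W by apply/subsetP.
by rewrite (card_uniqP Us) sz ltnn.
Qed.

(** Deleting a leaf from [W] loses at most one edge and exactly one vertex. *)
Lemma forest_card E W : loopless E -> triangle_free E -> chordal_edges E ->
  W != set0 -> #|[set e in E | e \subset W]| < #|W|.
Proof.
move=> lE tfE chE; move: {2}#|W| (leqnn #|W|) => n.
elim: n => [|n IH] in W *; first by rewrite leqn0 cards_eq0 => /eqP-> /eqP[].
move=> Wn W0; have [x xW leaf] := exists_leaf lE tfE chE W0.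
have cW := cardsD1 x W; rewrite xW add1n in cW.
have sub : [set e in E | e \subset W] \subset
    [set e in E | e \subset W :\ x] :|: [set e in E | (e \subset W) && (x \in e)].
  apply/subsetP=> e; rewrite !inE => /andP[-> eW]; rewrite eW subsetD1 eW /=.
  by case: (x \in e).
have leE := leq_trans (subset_leq_card sub) (leq_card_setU _ _).
case: (eqVneq (W :\ x) set0) => [W1|/IH]; last by rewrite -ltnS -cW => /(_ Wn); lia.
rewrite cW W1 cards0 ltnS leqn0 cards_eq0; apply/set0Pn => -[e /setIdP[eE eW]].
by have := subset_leq_card eW; rewrite lE // cW W1 cards0.
Qed.

End Chordal.

(** * The extremal bipartite graph and the upper bound *)

(** The sides are the first [r./2] vertices and the next [r - r./2]; any [m] edges between them
    serve. [R] records the vertices allowed to carry edges. *)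
Lemma bipartite_graph_exists (n m r : nat) : r <= n -> m <= t2 r ->
  exists (G : graph 'I_n) (R : {set 'I_n}),
   [/\ #|vertices G| = n, #|edges G| = m, #|R| = r,
      forall e, e \in edges G -> e \subset R & triangle_free (edges G)].
Proof.
move=> rn; rewrite t2_half => mr.
pose A := [set i : 'I_n | i < r./2]; pose R := [set i : 'I_n | i < r].
pose B := R :\: A.
have card_lt k : k <= n -> #|[set i : 'I_n | i < k]| = k.
  move=> kn; have winj : injective (widen_ord kn).
    by move=> i j /(congr1 val) /= ij; apply: val_inj.
  rewrite -[RHS]card_ord -(card_imset _ winj).
  apply: eq_card => i; rewrite inE; apply/idP/imsetP => [ik|[j _ ->]] //=.
  by exists (Ordinal ik) => //; apply: val_inj.
have hr : r./2 <= r by lia.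
have AR : A \subset R by apply/subsetP=> i; rewrite !inE => /leq_trans ->.
have cB : #|B| = r - r./2.
  by rewrite cardsD (setIidPr AR) !card_lt // (leq_trans hr).
pose f (p : 'I_n * 'I_n) := [set p.1; p.2].
have fK : {in setX A B &, injective f}.
  move=> [a b] [a' b'] /setXP[/= aA bB] /setXP[/= aA' bB'] /set2_pair /=.
  by case=> [[-> ->] //|[E1 _]]; move: bB'; rewrite -E1 inE aA.
pose D := f @: setX A B.
have cD : #|D| = r./2 * (r - r./2).
  by rewrite card_in_imset // cardsX cB card_lt // (leq_trans hr).
pose s := take m (enum D).
have sD e : e \in [set:: s] -> e \in D by rewrite inE => /mem_take; rewrite mem_enum.
have DP e : e \in D -> exists a b, [/\ a \in A, b \in B & e = [set a; b]].
  by case/imsetP => -[a b] /setXP[/= aA bB] ->; exists a, b.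
have sP e : e \in [set:: s] -> (e \subset [set: 'I_n]) && (#|e| == 2).
  move/sD/DP => [a [b [aA /setDP[_ bA] ->]]]; rewrite subsetT cards2.
  by rewrite (_ : a != b) //; apply: contraNneq bA => <-.
have sides x y : [set x; y] \in [set:: s] -> (x \in A) = (y \notin A).
  move/sD/DP => [a [b [aA /setDP[_ bA]]]] /set2_pair[[-> ->]|[-> ->]].
    by rewrite aA bA.
  by rewrite aA (negPf bA).
exists (Graph sP), R; split.
- by rewrite cardsT card_ord.
- rewrite /= cardsE (card_uniqP _) ?take_uniq ?enum_uniq //.
  by rewrite size_takel // -cardE cD.
- exact: card_lt.
- move=> e /sD/DP[a [b [aA /setDP[bR _] ->]]].
  by rewrite subUset !sub1set bR (subsetP AR).
(* Each edge changes sides, and a triangle would do so an odd number of times. *)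
move=> x y z /sides xy /sides yz; apply/negP => /sides.
by rewrite xy yz; case: (z \in A).
Qed.

Lemma triangle_freeS (T : finType) (E F : {set {set T}}) :
  F \subset E -> triangle_free E -> triangle_free F.
Proof.
move=> /subsetP FE tfE x y z /FE xy /FE yz; apply: contra (FE _) _.
exact: tfE xy yz.
Qed.

Lemma loopless_edges (T : finType) (G : graph T) : loopless (edges G).
Proof. by move=> e /edgesP/andP[_ /eqP]. Qed.

Theorem theorem1p4 (n m : nat) (hn : 1 <= n) (hm : m <= t2 n) :
  chordal_f n m = min_t2 m - 1.
Proof.
rewrite /min_t2; case: ex_minnP => r /andP[r1 mr] rmin.
(* By [hm], [n] is a candidate for the minimum, so [r] vertices fit among [n]. *)
have rn : r <= n by apply: rmin; rewrite hn.
have [G [R [vG eG cR GR tfG]]] := bipartite_graph_exists rn mr.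
have le_m : m <= 'C(n, 2).
  rewrite -eG; have := card_draws 'I_n 2; rewrite card_ord => <-.
  by apply/subset_leq_card/subsetP => e /edgesP; rewrite inE => /andP[].
have [fn fmax] := chordal_fP le_m.
apply/eqP; rewrite eqn_leq; apply/andP; split.
  have [H [[_ sH] chH]] := fn _ G vG eG.
  (* Counting the vertices of [R] alone yields [r - 1] and not [n - 1]. *)
  move/leq_trans; apply; rewrite -ltnS subn1 prednK // -cR.
  have -> : edges H = [set e in edges H | e \subset R].
    by apply/setP => e; rewrite inE; case: (boolP (e \in _)) => // /(subsetP sH)/GR.
  apply: forest_card.
  - exact: loopless_edges.
  - exact: triangle_freeS tfG.
  - exact/chordal_edgesP.
  - by rewrite -card_gt0 cR.
apply: fmax => T G' _ eG'.
have sV e : e \in edges G' -> e \subset vertices G' by case/edgesP/andP.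
have [F [FE chF mF]] := t2_chordal_subgraph (@loopless_edges _ G') sV.
have FP e : e \in F -> (e \subset vertices G') && (#|e| == 2).
  by move/(subsetP FE)/edgesP.
exists (Graph FP); split=> //; first exact/chordal_edgesP.
(* [#|F|.+1] is a candidate for the minimum [r]. *)
by rewrite /= leq_subLR add1n; apply: rmin; rewrite -eG'.
Qed.
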